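(* Let $G$ be a finite simple graph without isolated vertices, with vertices $v_1,\ldots,v_n$, edge set $\mathcal{E}(G)$, vector of vertex degrees $\mathbf{d}=(d_1,\ldots,d_n)$ (where $d_i=d(v_i)$), maximum degree $\Delta$, and adjacency matrix $A$. Let $\mathbf{d}^{(2)}=(d_1^{(2)},\ldots,d_n^{(2)})=A\mathbf{d}$ be the vector of second degrees of $G$. Then $$s_Q(G)\ \ge\ \left|\frac{\sum_{i=1}^n d_i^3+\sum_{i=1}^n d_i d_i^{(2)}}{M_1(G)}-\Upsilon\right|,$$ where $$\Upsilon=\min_{\substack{v_pv_q\in\mathcal{E}(G)\\ d(v_q)=\Delta}}\left\{\frac{\Delta+d_p}{2}-\sqrt{\left(\frac{\Delta+d_p}{2}\right)^2+1-\Delta d_p}\right\}.$$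
   Context: For a finite simple graph $G$ on $n$ vertices, let $A_G$ be its adjacency matrix and $D_G$ the diagonal matrix of vertex degrees. The signless Laplacian matrix is $Q_G=D_G+A_G$ with eigenvalues $q_1\ge q_2\ge\cdots\ge q_n$, and the signless Laplacian spread is $s_Q(G)=q_1-q_n$. The first Zagreb index is $M_1(G)=\sum_{i=1}^n d_i^2$. *)

(* Defs.v *)
From mathcomp Require Import all_boot all_order all_algebra.
From mathcomp Require Export polyrcf.

Set Implicit Arguments.
Unset Strict Implicit.
Unset Printing Implicit Defensive.

Import Order.TTheory GRing.Theory Num.Theory.
Local Open Scope ring_scope.

Section RealSpectrum.
Variables (R : rcfType) (n : nat).

(* The eigenvalues lying in R, repeated according to their algebraic           *)
(* multiplicity, in nonincreasing order.  When M is symmetric its              *)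
(* characteristic polynomial splits over R, so this list has n entries         *)
(* q_1 >= ... >= q_n.                                                          *)
Definition eigenvalues (M : 'M[R]_n) : seq R :=
  sort >=%R (flatten [seq nseq (mup x (char_poly M)) x
                     | x <- rootsR (char_poly M)]).

Definition spread (M : 'M[R]_n) : R :=
  head 0 (eigenvalues M) - last 0 (eigenvalues M).

End RealSpectrum.

(* The value on the empty list is an irrelevant default.                       *)
Definition minseq (R : realDomainType) (s : seq R) : R :=
  \big[Num.min/head 0 s]_(x <- s) x.

Section Graph.
Variables (n : nat) (e : rel 'I_n).

Definition deg (i : 'I_n) : nat := #|[set j | e i j]|.

Definition maxdeg : nat := \max_(i < n) deg i.

Variable R : rcfType.

Definition adj_mx : 'M[R]_n := \matrix_(i, j) (e i j)%:R.

Definition deg_vec : 'cV[R]_n := \col_i (deg i)%:R.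

Definition deg2_vec : 'cV[R]_n := adj_mx *m deg_vec.

Definition signless_laplacian : 'M[R]_n := diag_mx deg_vec^T + adj_mx.

Definition signless_spread : R := spread signless_laplacian.

Definition zagreb1 : R := \sum_(i < n) deg_vec i 0 ^+ 2.

(* The pairs pq = (p, q) are the oriented edges whose second endpoint has      *)
(* maximum degree.                                                             *)
Definition Upsilon : R :=
  minseq [seq (let m := (maxdeg%:R + deg_vec pq.1 0) / 2 in
               m - Num.sqrt (m ^+ 2 + 1 - maxdeg%:R * deg_vec pq.1 0))
         | pq in [pred pq : 'I_n * 'I_n |
                   e pq.1 pq.2 && (deg pq.2 == maxdeg)]].

End Graph.

(* Main.v *)
(** The Rayleigh quotients of a real symmetric matrix lie between its extreme
    eigenvalues, so any two of them differ by at most the spread.  For the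
    signless Laplacian, the degree vector has the quotient
    (sum d_i^3 + sum d_i d_i^(2)) / M_1, while Upsilon is the least eigenvalue of
    the 2 x 2 principal submatrix [[Delta, 1], [1, d_p]] on some edge v_q v_p,
    hence the quotient of an eigenvector of it extended by zeros.  The symmetric
    spectral theorem over R is read off the Hermitian one over R[i]. *)
Require Import Defs.
From mathcomp Require Import all_boot all_order all_algebra.
From mathcomp Require Import complex ring lra.

Set Implicit Arguments.
Unset Strict Implicit.
Unset Printing Implicit Defensive.

Import Order.TTheory GRing.Theory Num.Theory.
Local Open Scope ring_scope.

Lemma mem_eigenvalues (R : rcfType) (n : nat) (M : 'M[R]_n) (r : R) :
  root (char_poly M) r -> r \in eigenvalues M.
Proof.
move=> rt; have p0 : char_poly M != 0 by rewrite monic_neq0 ?char_poly_monic.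
rewrite mem_sort; apply/flattenP; exists (nseq (mup r (char_poly M)) r).
  by apply/map_f; rewrite -(roots_on_rootsR p0) rt andbT in_itv.
(* A root has positive multiplicity, so its block of copies is not empty. *)
by rewrite mem_nseq -XsubC_dvd // dvdp_XsubCl rt eqxx.
Qed.

Lemma eigenvalues_bounds (R : rcfType) (n : nat) (M : 'M[R]_n) (r : R) :
  root (char_poly M) r ->
  last 0 (eigenvalues M) <= r <= head 0 (eigenvalues M).
Proof.
move=> /mem_eigenvalues rM.
have sM : sorted >=%R (eigenvalues M).
  by apply: sort_sorted => x y; exact: le_total.
have mono := sorted_leq_nth (rev_trans le_trans) (@lexx _ R) 0 sM.
case/(nthP 0): rM => i iM <-; have szM := leq_ltn_trans (leq0n i) iM.
rewrite -nth0 -nth_last; apply/andP; split; apply: mono => //.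
  by rewrite inE prednK.
by rewrite -ltnS prednK.
Qed.

Lemma minseq_mem (R : realDomainType) (s : seq R) : s != [::] -> minseq s \in s.
Proof.
move=> s0; rewrite /minseq big_seq; elim/big_ind: _ => //.
  (* The default [head 0 s] is itself an entry, since [s] is nonempty. *)
  by case: s s0 => //= x s _; rewrite mem_head.
by move=> x y xs ys; rewrite /Order.min; case: ifP.
Qed.

Local Open Scope sesquilinear_scope.

(** The weights [w i] are the squared moduli of the coordinates of [x] in a unitary eigenbasis over
    [R[i]]. They and the eigenvalues are real, so no eigenbasis over [R] has to be built. *)
Lemma rayleigh_decomposition (R : rcfType) (n : nat) (M : 'M[R]_n)
    (x : 'cV[R]_n) :
  M^T = M ->
  exists r w : 'I_n -> R,
  [/\ forall i, root (char_poly M) (r i), forall i, 0 <= w i,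
      (x^T *m x) 0 0 = \sum_i w i & (x^T *m M *m x) 0 0 = \sum_i r i * w i].
Proof.
move=> Msym; pose f := real_complex R; pose A := map_mx f M.
have Areal : A \is a mxOver Num.real.
  by apply/mxOverP => i j; rewrite mxE; apply/complex_realP; exists (M i j).
have Asym : A \is symmetricmx.
  by apply/is_hermitianmxP; rewrite expr0 scale1r map_mx_id // map_trmx Msym.
have Aherm := realsym_hermsym Asym Areal.
have /orthomx_spectralP AE := hermitian_normalmx Aherm.
have dreal := hermitian_spectral_diag_real Aherm.
have Punit := spectral_unitarymx A; have Pinv := spectral_unit A.
move: AE dreal Punit Pinv; set P := spectralmx A; set D := spectral_diag A.
move=> AE /mxOverP dreal Punitary Pinv.
pose r i := complex.Re (D 0 i).
have rE i : f (r i) = D 0 i by apply: RRe_real.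
(* The rows of [P] are orthonormal eigenvectors; [y] holds the coordinates of [x^T] in this
   basis. *)
pose v := map_mx f x^T; pose y := v *m P^t*.
have vJ : v^t* = map_mx f x.
  apply/matrixP => i j; rewrite !mxE.
  by apply/CrealP/complex_realP; exists (x i j).
have yJ : y^t* = P *m map_mx f x.
  rewrite trmx_mul map_mxM vJ map_trmx trmxK -map_mx_comp.
  by rewrite (map_mx_id (@conjCK _)).
have PA : P *m A = diag_mx D *m P by rewrite {1}AE -mulmxA mulKVmx.
exists r, (fun i => complex.Re (`|y 0 i| ^+ 2)).
have wE i : f (complex.Re (`|y 0 i| ^+ 2)) = `|y 0 i| ^+ 2.
  by apply: RRe_real; rewrite rpredX // normr_real.
have fE (B : 'M[R]_1) : f (B 0 0) = (map_mx f B) 0 0 by rewrite mxE.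
have fS (F : 'I_n -> R) : f (\sum_i F i) = \sum_i f (F i).
  exact: rmorph_sum.
have fM a b : f (a * b) = f a * f b by exact: rmorphM.
have yyE i : `|y 0 i| ^+ 2 = y 0 i * y^t* i 0 by rewrite normCK !mxE.
split.
(* Row [i] of [P] is a left eigenvector for [D 0 i], nonzero because [P] is invertible. *)
- move=> i; rewrite -(fmorph_root f) map_char_poly -/A -eigenvalue_root_char.
  apply/eigenvalueP; exists (row i P).
    by rewrite -row_mul PA row_mul row_diag_mx -rE -scalemxAl -rowE.
  rewrite rowE mulmx_free_eq0 ?row_free_unit //.
  by apply/eqP => /matrixP/(_ 0 i)/eqP; rewrite !mxE !eqxx oner_eq0.
- by move=> i; rewrite -ler0c -/f wE exprn_ge0.
(* Both identities are checked in [R[i]], where the two sums are the products of [y] and of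
   [y *m diag_mx D] with [y^t*]. *)
- apply: (@complexI R); rewrite -/f fE map_mxM -/v fS.
  under eq_bigr do rewrite wE yyE.
  suff -> : v *m map_mx f x = y *m y^t* by rewrite mxE.
  by rewrite yJ /y -invmx_unitary // mulmxA mulmxKV.
- apply: (@complexI R); rewrite -/f fE 2!map_mxM -/v -/A fS.
  under eq_bigr do rewrite fM wE yyE mulrA rE.
  suff -> : v *m A *m map_mx f x = y *m diag_mx D *m y^t*.
    by rewrite mxE; apply: eq_bigr => i _; rewrite mul_mx_diag mxE (mulrC (D 0 i)).
  by rewrite yJ AE /y -invmx_unitary // !mulmxA.
Qed.

Local Close Scope sesquilinear_scope.

(** Each [r i] in the weighted sum is bounded by the extreme eigenvalues. The division-free form
    also covers [x = 0]. *)
Lemma rayleigh_bounds (R : rcfType) (n : nat) (M : 'M[R]_n) (x : 'cV[R]_n) :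
  M^T = M ->
  last 0 (eigenvalues M) * (x^T *m x) 0 0 <= (x^T *m M *m x) 0 0
    <= head 0 (eigenvalues M) * (x^T *m x) 0 0.
Proof.
move=> /(rayleigh_decomposition x)[r [w [rt w0 -> ->]]].
rewrite !mulr_sumr; apply/andP; split; apply: ler_sum => i _;
  by apply: ler_wpM2r => //; case/andP: (eigenvalues_bounds (rt i)).
Qed.

Lemma rayleigh_spread (R : rcfType) (n : nat) (M : 'M[R]_n) (x y : 'cV[R]_n)
    (a b : R) :
  M^T = M -> 0 < (x^T *m x) 0 0 -> 0 < (y^T *m y) 0 0 ->
  (x^T *m M *m x) 0 0 = a * (x^T *m x) 0 0 ->
  (y^T *m M *m y) 0 0 = b * (y^T *m y) 0 0 ->
  `|a - b| <= spread M.
Proof.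
move=> Msym x0 y0 xE yE.
have := rayleigh_bounds x Msym; rewrite xE !ler_pM2r // => /andP[la ha].
have := rayleigh_bounds y Msym; rewrite yE !ler_pM2r // => /andP[lb hb].
by rewrite /spread ler_norml; apply/andP; split; lra.
Qed.

Lemma signless_laplacian_sym (R : rcfType) (n : nat) (e : rel 'I_n) :
  symmetric e -> (signless_laplacian e R)^T = signless_laplacian e R.
Proof.
move=> e_sym; rewrite linearD /= tr_diag_mx; congr (_ + _).
by apply/matrixP => i j; rewrite !mxE e_sym.
Qed.

Lemma rayleigh_deg_vec (R : rcfType) (n : nat) (e : rel 'I_n) :
  let d := deg_vec e R in
  (d^T *m signless_laplacian e R *m d) 0 0 =
    \sum_(i < n) d i 0 ^+ 3 + \sum_(i < n) d i 0 * deg2_vec e R i 0.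
Proof.
move=> d; rewrite mulmxDr mulmxDl mxE; congr (_ + _).
  by rewrite mxE; apply: eq_bigr => i _; rewrite mul_mx_diag !mxE; ring.
by rewrite -mulmxA mxE; apply: eq_bigr => i _; rewrite !mxE.
Qed.

Lemma sqnorm_deg_vec (R : rcfType) (n : nat) (e : rel 'I_n) :
  ((deg_vec e R)^T *m deg_vec e R) 0 0 = zagreb1 e R.
Proof. by rewrite mxE; apply: eq_bigr => i _; rewrite !mxE -expr2. Qed.

Lemma zagreb1_gt0 (R : rcfType) (n : nat) (e : rel 'I_n) (i j : 'I_n) :
  e i j -> 0 < zagreb1 e R.
Proof.
move=> eij; rewrite /zagreb1 (bigD1 i) //= ltr_pwDl //.
  rewrite exprn_gt0 // mxE ltr0n card_gt0; apply/set0Pn.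
  by exists j; rewrite inE.
by apply: sumr_ge0 => k _; apply: sqr_ge0.
Qed.

(** Serves twice: the signless Laplacian gives the quadratic form of a principal 2 x 2 submatrix,
    and the identity matrix gives the squared norm of the same vector. *)
Lemma quad_delta_pair (R : comNzRingType) (n : nat) (M : 'M[R]_n)
    (i j : 'I_n) (t : R) :
  let x : 'cV[R]_n := delta_mx i 0 + t *: delta_mx j 0 in
  (x^T *m M *m x) 0 0 = M i i + t * (M i j + M j i) + t ^+ 2 * M j j.
Proof.
have dE k l : (delta_mx 0 k *m M *m delta_mx l 0 : 'M_1) 0 0 = M k l.
  by rewrite -rowE -colE !mxE.
move=> x; have -> : x^T = delta_mx 0 i + t *: delta_mx 0 j.
  by rewrite linearD linearZ /= !trmx_delta.
have addE (A B : 'M[R]_1) : (A + B) 0 0 = A 0 0 + B 0 0 by rewrite mxE.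
have scaleE a (A : 'M[R]_1) : (a *: A) 0 0 = a * A 0 0 by rewrite mxE.
rewrite /x !(mulmxDl, mulmxDr) -!(scalemxAl, scalemxAr) !(addE, scaleE) !dE; ring.
Qed.

(** A vertex of maximum degree exists and has a neighbor, so the minimum runs over a nonempty list
    and is one of its entries. *)
Lemma Upsilon_attained (R : rcfType) (n : nat) (e : rel 'I_n) :
  (0 < n)%N -> (forall i, exists j, e i j) -> symmetric e ->
  exists p q : 'I_n, [/\ e p q, deg e q = maxdeg e &
    let m := ((maxdeg e)%:R + deg_vec e R p 0) / 2 in
    Upsilon e R =
      m - Num.sqrt (m ^+ 2 + 1 - (maxdeg e)%:R * deg_vec e R p 0)].
Proof.
move=> n_gt0 noiso e_sym.
have [|q qE] := @bigop.eq_bigmax _ (deg e); first by rewrite card_ord.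
have [p epq] := noiso q.
rewrite /Upsilon; set s := (X in minseq X).
have : minseq s \in s.
  apply: minseq_mem; rewrite -size_eq0 size_map -cardE -lt0n.
  by apply/card_gt0P; exists (p, q); rewrite inE /= e_sym epq -qE eqxx.
case/mapP=> -[p' q']; rewrite mem_enum inE /= => /andP[epq' /eqP qmax] ->.
by exists p', q'.
Qed.

(* [lam] is an eigenvalue of [[a, 1], [1, b]], with eigenvector [(1, lam - a)]. *)
Lemma eigen2_eq (R : rcfType) (a b : R) :
  let m := (a + b) / 2 in
  let lam := m - Num.sqrt (m ^+ 2 + 1 - a * b) in
  (lam - a) * (lam - b) = 1.
Proof.
move=> m lam; have disc_ge0 : 0 <= m ^+ 2 + 1 - a * b.
  have -> : m ^+ 2 + 1 - a * b = ((a - b) / 2) ^+ 2 + 1 by rewrite /m; field.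
  by rewrite addr_ge0 ?sqr_ge0.
have := sqr_sqrtr disc_ge0; rewrite /lam; move: (Num.sqrt _) => s sE.
have -> : (m - s - a) * (m - s - b) = s ^+ 2 - m ^+ 2 + a * b by rewrite /m; field.
by rewrite sE; ring.
Qed.

Theorem theorem27 (R : rcfType) (n : nat) (e : rel 'I_n)
    (n_gt0 : (0 < n)%N)
    (e_sym : symmetric e) (e_irr : irreflexive e)
    (no_isolated : forall i : 'I_n, exists j : 'I_n, e i j) :
  let d := deg_vec e R in
  let d2 := deg2_vec e R in
  signless_spread e R >=
    `| (\sum_(i < n) d i 0 ^+ 3 + \sum_(i < n) d i 0 * d2 i 0) / zagreb1 e R
       - Upsilon e R |.
Proof.
cbv zeta; set d := deg_vec e R; have [j ej] := no_isolated (Ordinal n_gt0).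
have [p [q [epq qmax /= UE]]] := Upsilon_attained R n_gt0 no_isolated e_sym.
have := eigen2_eq (maxdeg e)%:R (deg_vec e R p 0); rewrite /= -UE => eq1.
set U := Upsilon e R in eq1 *; set D : R := (maxdeg e)%:R in eq1.
(* The eigenvector [(1, U - D)] for [U], with its first entry at [q], the vertex of degree [D]. *)
pose x : 'cV[R]_n := delta_mx q 0 + (U - D) *: delta_mx p 0.
have pq : (p == q) = false by apply: contraTF epq => /eqP ->; rewrite e_irr.
have xx : (x^T *m x) 0 0 = 1 + (U - D) ^+ 2.
  rewrite -[x^T]mulmx1 quad_delta_pair !mxE !eqxx pq eq_sym pq /=; ring.
apply: (rayleigh_spread (x := d) (y := x)).
- exact: signless_laplacian_sym.
- by rewrite sqnorm_deg_vec (zagreb1_gt0 _ ej).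
- by rewrite xx ltr_pwDl ?sqr_ge0.
- by rewrite rayleigh_deg_vec sqnorm_deg_vec divfK // gt_eqF // (zagreb1_gt0 _ ej).
- rewrite xx quad_delta_pair !mxE !eqxx pq eq_sym pq e_sym epq !e_irr qmax -/D.
  rewrite mxE in eq1; set b := (deg e p)%:R in eq1 *.
  rewrite /= mulr1n mulr0n add0r addr0; apply/eqP; rewrite -subr_eq0; apply/eqP.
  (* With [t = U - D], the difference [D + 2t + t^2 b - U(1 + t^2)] factors as [t(1 - t(U - b))],
     and [eq1] says [t(U - b) = 1]. *)
  transitivity ((U - D) * (1 - (U - D) * (U - b))); first by ring.
  by rewrite eq1 subrr mulr0.
Qed.
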